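(* Let $(X,\mathsf d)$ be a complete and separable metric space. The map $F\colon A(X)\to\mathbb R\cup\{\infty\}$ defined by $$F(x,\gamma):=\begin{cases}|d\gamma|(\gamma^{-1}(x)) & \text{if it exists},\\ \infty & \text{otherwise},\end{cases}$$ is Borel.
   Context: $\Gamma(X)$ is the set of biLipschitz maps $\gamma\colon\mathrm{Dom}(\gamma)\to X$ with $\mathrm{Dom}(\gamma)\subset\mathbb R$ non-empty and compact; $\gamma_t:=\gamma(t)$. $H(X)$ is the collection of non-empty compact subsets of $\mathbb R\times X$ with the Hausdorff metric (it is complete and separable). $\Gamma(X)$ is identified with a subset of $H(X)$ via $\gamma\mapsto\mathrm{graph}(\gamma)$, and $$A(X):=\{(x,\gamma)\in X\times\Gamma(X):\ \exists\, t\in\mathrm{Dom}(\gamma),\ x=\gamma_t\}\subset X\times H(X),$$ with the subspace topology. (It is known that $\Gamma(X)$ is a Borel subset of $H(X)$ and $A(X)$ a Borel subset of $X\times H(X)$.) Metric differentiability: Borel sets $E_i\subset\mathbb R$ shrink nicely to $t$ if there are $r_i>0$ and $\alpha>0$ with $E_i\subset B_{r_i}(t)$ and $\mathcal L^1(E_i)\ge\alpha\,\mathcal L^1(B_{r_i}(t))$ for all $i$. A curve $\gamma$ is metric differentiable at $t\in\mathrm{Dom}(\gamma)$ if the limit of $\mathsf d(\gamma_{t+s},\gamma_{t+\tau})/|s-\tau|$ exists along all sequences $s,\tau\to0$ with $t+s,t+\tau\in\mathrm{Dom}(\gamma)$ such that the intervals with endpoints $t+s$ and $t+\tau$ shrink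 nicely to $t$; the common limit is denoted $|d\gamma|(t)$, and one says that $|d\gamma|(t)$ exists. If $t$ is an isolated point of $\mathrm{Dom}(\gamma)$ (so that there are no such sequences), $|d\gamma|(t)$ is regarded as not existing. *)

(* Defs.v *)
From HB Require Import structures.
From mathcomp Require Import all_boot all_order all_algebra.
From mathcomp Require Import all_classical all_reals all_analysis.

Set Implicit Arguments.
Unset Strict Implicit.
Unset Printing Implicit Defensive.

Import Order.TTheory GRing.Theory Num.Theory.
Import numFieldNormedType.Exports.

Local Open Scope classical_set_scope.
Local Open Scope ring_scope.

(* The library's [completeType] is a pointed type; this is the same condition
   on an arbitrary, possibly empty, uniform space. *)
Definition complete_space (T : uniformType) :=
  forall F : set_system T, ProperFilter F -> cauchy F -> exists x : T, F --> x.

Definition separable_space (T : topologicalType) :=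
  exists D : set T, countable D /\ dense D.

Definition Borel_map (T U : topologicalType) (f : T -> U) :=
  forall B : set U, <<s @open U >> B -> <<s @open T >> (f @^-1` B).

(* The max distance on a product of metric spaces; it induces the uniform
   structure that the library puts on the product. *)
Section prod_metric.
Context {R : realType} {T U : metricType R}.
Implicit Types p q : T * U.

Definition prod_mdist p q := Num.max (mdist p.1 q.1) (mdist p.2 q.2).

Let prod_mdist_ge0 p q : 0 <= prod_mdist p q.
Proof. by rewrite le_max mdist_ge0. Qed.

Let prod_mdist_positivity p q : prod_mdist p q = 0 -> p = q.
Proof.
case: p q => [x y] [x' y'] /= pq0.
have le0 : prod_mdist (x, y) (x', y') <= 0 by rewrite pq0.
move: le0; rewrite ge_max /= => /andP[xx' yy'].
by congr (_, _); apply: mdist_positivity; apply/eqP;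
  rewrite eq_le mdist_ge0 andbT.
Qed.

Let ballE p d : ball p d = [set q | prod_mdist p q < d].
Proof.
apply/seteqP; split=> q /=; rewrite /ball /= /prod_ball !ballEmdist /=.
  by case=> ? ?; rewrite gt_max; apply/andP.
by rewrite gt_max => /andP.
Qed.

HB.instance Definition _ := PseudoMetric_isMetric.Build R (T * U)%type
  prod_mdist_ge0 prod_mdist_positivity ballE.

End prod_metric.

Record hyperspace (R : realType) (T : metricType R) := Hyperspace {
  hset :> set T ;
  hset_nonempty : hset !=set0 ;
  hset_compact : compact hset }.

Section hausdorff_metric.
Context {R : realType} {T : metricType R}.
Implicit Types A B C : hyperspace T.

Definition hausdorff_radii A B := [set e : R | [/\ 0 < e,
  A `<=` \bigcup_(y in B) ball y e & B `<=` \bigcup_(x in A) ball x e]].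

Definition hausdorff_dist A B := inf (hausdorff_radii A B).

Lemma hyperspace_inj A B : A = B :> set T -> A = B.
Proof.
case: A B => [A An Ac] [B Bn Bc] /= AB; rewrite -{}AB in Bn Bc *.
by rewrite (Prop_irrelevance An Bn) (Prop_irrelevance Ac Bc).
Qed.

Lemma mdist_continuous (a : T) : continuous (fun x => mdist a x : R).
Proof.
move=> x; apply/cvgrPdist_lt => e e0; near=> y.
have xy : mdist x y < e.
  by near: y; apply/nbhs_ballP; exists e => //= z; rewrite ballEmdist.
rewrite (le_lt_trans _ xy)// ler_norml; apply/andP; split.
  by rewrite lerBrDl lerBlDr metric_triangle.
by rewrite lerBlDr addrC [X in _ + X]metric_sym metric_triangle.
Unshelve. all: by end_near. Qed.

Lemma hyperspace_bounded A (a : T) :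
  exists2 M : R, 0 < M & forall x, hset A x -> mdist a x < M.
Proof.
have /compact_bounded[N [_ /(_ (N + 1))]] : compact ((mdist a : T -> R) @` A).
  apply: continuous_compact; last exact: hset_compact.
  by apply: continuous_subspaceT; exact: mdist_continuous.
rewrite ltrDl => /(_ ltr01) AN; exists (`|N + 1| + 1).
  by rewrite (lt_le_trans ltr01)// lerDr.
move=> x Ax; rewrite (@le_lt_trans _ _ `|N + 1|) ?ltrDl//.
have := AN _ (imageP _ Ax).
rewrite /= (ger0_norm (mdist_ge0 _ _)) => /le_trans; apply.
exact: ler_norm.
Qed.

Lemma hausdorff_radii_nonempty A B : hausdorff_radii A B !=set0.
Proof.
have [a Aa] := hset_nonempty A; have [b Bb] := hset_nonempty B.
have [M M0 AM] := hyperspace_bounded A b.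
have [N N0 BN] := hyperspace_bounded B a.
exists (M + N); split; first exact: addr_gt0.
- move=> x Ax; exists b => //; rewrite ballEmdist /=.
  by rewrite (lt_trans (AM _ Ax))// ltrDl.
- move=> y By; exists a => //; rewrite ballEmdist /=.
  by rewrite (lt_trans (BN _ By))// ltrDr.
Qed.

Lemma hausdorff_radii_lbound A B : lbound (hausdorff_radii A B) 0.
Proof. by move=> e [/ltW]. Qed.

Lemma hausdorff_radii_has_inf A B : has_inf (hausdorff_radii A B).
Proof.
split; first exact: hausdorff_radii_nonempty.
by exists 0; exact: hausdorff_radii_lbound.
Qed.

Let radiiC A B : hausdorff_radii A B = hausdorff_radii B A.
Proof. by apply/seteqP; split => e []. Qed.

Let dist_ge0 A B : 0 <= hausdorff_dist A B.
Proof.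
apply: lb_le_inf; first exact: hausdorff_radii_nonempty.
exact: hausdorff_radii_lbound.
Qed.

Let distxx A : hausdorff_dist A A = 0.
Proof.
apply/eqP; rewrite eq_le dist_ge0 andbT; apply/ler_addgt0Pl => e e0.
rewrite addr0; apply: ge_inf; first by exists 0; exact: hausdorff_radii_lbound.
by split => // x Ax; exists x => //; exact: ballxx.
Qed.

Let dist_sub A B : hausdorff_dist A B = 0 -> A `<=` B.
Proof.
move=> AB0 x Ax.
have /closure_id -> : closed B.
  by apply: compact_closed; [exact: metric_hausdorff|exact: hset_compact].
move=> V /nbhs_ballP[e /= e0 eV].
have [d [_ AB _] de] := inf_adherent e0 (hausdorff_radii_has_inf A B).
have [y By /ball_sym yx] := AB _ Ax; exists y; split => //.
apply: eV; apply: le_ball yx; apply: ltW.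
by move: de; rewrite -/(hausdorff_dist A B) AB0 add0r.
Qed.

Let distC A B : hausdorff_dist A B = hausdorff_dist B A.
Proof. by rewrite /hausdorff_dist radiiC. Qed.

Let dist_positivity A B : hausdorff_dist A B = 0 -> A = B.
Proof.
move=> AB0; apply: hyperspace_inj; apply/seteqP; split; apply: dist_sub => //.
by rewrite distC.
Qed.

Let dist_triangle B A C :
  hausdorff_dist A C <= hausdorff_dist A B + hausdorff_dist B C.
Proof.
apply/ler_addgt0Pl => e e0.
have e20 : 0 < e / 2 by rewrite divr_gt0.
have [r [r0 AB BA] rlt] := inf_adherent e20 (hausdorff_radii_has_inf A B).
have [s [s0 BC CB] slt] := inf_adherent e20 (hausdorff_radii_has_inf B C).
apply: (@le_trans _ _ (r + s)); last first.
  by rewrite [e]splitr addrACA; apply: lerD; rewrite addrC; exact: ltW.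
apply: ge_inf; first by exists 0; exact: hausdorff_radii_lbound.
split; first exact: addr_gt0.
- move=> x /AB[y /BC[z Cz yz] xy]; exists z => //.
  by rewrite addrC; exact: ball_triangle yz xy.
- move=> z /CB[y /BA[x Ax yx] zy]; exists x => //.
  exact: ball_triangle yx zy.
Qed.

HB.instance Definition _ := gen_eqMixin (hyperspace T).
HB.instance Definition _ := gen_choiceMixin (hyperspace T).
HB.instance Definition _ := isMetric.Build R (hyperspace T)
  distxx dist_positivity distC dist_triangle.

End hausdorff_metric.

(* [dom] is coerced to the type of its elements, so that a curve is a function
   on its domain and nowhere else. *)
Record bilip_curve (R : realType) (X : metricType R) := BilipCurve {
  dom : set R ;
  curve :> dom -> X ;
  dom_nonempty : dom !=set0 ;
  dom_compact : compact dom ;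
  curve_bilip : exists2 L : R, 1 <= L & forall s t : dom,
    L^-1 * `|val s - val t| <= mdist (curve s) (curve t) <=
      L * `|val s - val t| }.

Section curve_topology.
Context {R : realType} {X : metricType R}.
Implicit Types g : bilip_curve X.

Definition graph_set g : set (R^o * X) :=
  range (fun t : dom g => (val t : R^o, g t)).

Lemma curve_inj g : injective g.
Proof.
move=> s t gst; have [L L1 /(_ s t)/andP[+ _]] := curve_bilip g.
rewrite gst mdistxx pmulr_rle0 ?invr_gt0 ?(lt_le_trans ltr01)//.
by rewrite normr_le0 subr_eq0 => /eqP/val_inj.
Qed.

Lemma graph_set_nonempty g : graph_set g !=set0.
Proof.
have [t gt] := dom_nonempty g.
by exists (t, g (SigSub (mem_set gt))); exists (SigSub (mem_set gt)).
Qed.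

Lemma curve_continuous g : continuous g.
Proof.
have [L L1 gL] := curve_bilip g.
have L0 : 0 < L by exact: lt_le_trans L1.
move=> t.
apply/(metricType_numDomainType.cvgrPdist_lt (FF := nbhs_filter t)) => e e0.
have vt : (val : dom g -> R) @ t --> val t by exact: initial_continuous.
have /(cvgrPdist_lt (FF := nbhs_filter t))/(_ _ (divr_gt0 e0 L0)) := vt.
apply: filterS => s ts; have /andP[_ /le_lt_trans] := gL t s; apply.
by rewrite mulrC -ltr_pdivlMr.
Qed.

Lemma graph_set_compact g : compact (graph_set g).
Proof.
have [t0 dt0] := dom_nonempty g.
pose f (t : dom g) : R^o * X := (val t : R^o, g t).
have cf : continuous f.
  move=> t.
  have vt : (val : dom g -> R^o) @ t --> (val t : R^o).
    exact: initial_continuous.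
  exact: (cvg_pair (FF := nbhs_filter t) vt (@curve_continuous g t)).
set v := f (SigSub (mem_set dt0)).
have vE t : valL_ v f (val t) = f t := congr1 (@^~ t) (valLK v f).
have -> : graph_set g = valL_ v f @` dom g.
  apply/seteqP; split=> p.
    by case=> t _ <-; exists (val t); [exact: set_valP|exact: vE].
  case=> t dt <-; exists (SigSub (mem_set dt)) => //.
  by rewrite -/(f _) -vE.
apply: continuous_compact; last exact: dom_compact.
by apply/subspace_valL_continuousP'.
Qed.

Definition graph g : hyperspace (R^o * X)%type :=
  Hyperspace (graph_set_nonempty g) (@graph_set_compact g).

Lemma graph_inj : injective graph.
Proof.
move=> g h /(congr1 (@hset _ _)) /= gh.
have gval (t : dom g) : exists2 s : dom h, val s = val t & h s = g t.
  have : graph_set h (val t : R^o, g t) by rewrite -gh; exists t.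
  by case=> s _ [st hst]; exists s.
have hval (t : dom h) : exists2 s : dom g, val s = val t & g s = h t.
  have : graph_set g (val t : R^o, h t) by rewrite gh; exists t.
  by case=> s _ [st hst]; exists s.
have dgh : dom g = dom h.
  apply/seteqP; split => t dt.
    have [s /= st _] := gval (SigSub (mem_set dt)).
    by rewrite -st; exact: set_valP.
  have [s /= st _] := hval (SigSub (mem_set dt)).
  by rewrite -st; exact: set_valP.
case: g h {gh} gval hval dgh => [D f Dn Dc fL] [D' f' Dn' Dc' fL'] /=.
move=> fval _ DD'; case: D' / DD' => /= in f' Dn' Dc' fL' fval *.
have ff' : f = f'.
  by apply/funext => t; have [s /val_inj <-] := fval t.
case: f' / ff' in fL' fval *.
by congr BilipCurve; exact: Prop_irrelevance.
Qed.

End curve_topology.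

(* A curve is identified with its graph: the topology on curves is the one
   making [graph] an embedding into the hyperspace of [R^o * X]. *)
HB.instance Definition _ (R : realType) (X : metricType R) :=
  gen_eqMixin (bilip_curve X).
HB.instance Definition _ (R : realType) (X : metricType R) :=
  gen_choiceMixin (bilip_curve X).
HB.instance Definition _ (R : realType) (X : metricType R) :=
  Topological.copy (bilip_curve X) (initial_topology (@graph R X)).

Section metric_derivative.
Context {R : realType} {X : metricType R}.

(* Unlike the library's [nicely_shrinking], the radii are not required to tend
   to zero. *)
Definition shrink_nicely (t : R) (E : (set R)^nat) :=
  (forall i, measurable (E i)) /\
  exists (r : R^nat) (alpha : R), 0 < alpha /\ forall i,
    [/\ 0 < r i, E i `<=` ball t (r i) &
      (alpha%:E * lebesgue_measure (ball t (r i)) <= lebesgue_measure (E i))%E].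

Definition segment (a b : R) : set R := `[Num.min a b, Num.max a b].

(* At an isolated point no sequences are admissible and every [l] would
   vacuously be a limit, so such points are excluded. *)
Definition is_metric_derivative (g : bilip_curve X) (t : dom g) (l : R) :=
  ~ isolated (dom g) (val t) /\
  forall (s tau : R^nat)
    (hs : forall n, val t + s n \in dom g)
    (htau : forall n, val t + tau n \in dom g),
    s n @[n --> \oo] --> (0 : R) -> tau n @[n --> \oo] --> (0 : R) ->
    shrink_nicely (val t) (fun n => segment (val t + s n) (val t + tau n)) ->
    mdist (g (SigSub (hs n))) (g (SigSub (htau n))) / `|s n - tau n|
      @[n --> \oo] --> l.

Definition metric_differentiable (g : bilip_curve X) (t : dom g) :=
  exists l : R, is_metric_derivative t l.

Definition metric_derivative (g : bilip_curve X) (t : dom g)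
  (h : metric_differentiable t) : R := projT1 (cid h).

Definition curve_points : set (X * bilip_curve X) :=
  [set p | exists t : dom p.2, p.1 = p.2 t].

Definition curve_preimage (p : curve_points) : dom (val p).2 :=
  projT1 (cid (set_mem (valP p))).

(* The extended real line stands for R with +oo added: -oo is never a value. *)
Definition metric_speed (p : curve_points) : \bar R :=
  match pselect (metric_differentiable (curve_preimage p)) with
  | left h => (metric_derivative h)%:E
  | right _ => +oo%E
  end.

End metric_derivative.

(* Main.v *)
Require Import Defs.
From HB Require Import structures.
From mathcomp Require Import all_boot all_order all_algebra.
From mathcomp Require Import all_classical all_reals all_analysis.
From mathcomp Require Import ring lra.

(* Since the inverse of a biLipschitz curve is Lipschitz, the time
   [t = gamma^{-1}(x)] depends continuously on [(x, gamma)]; and if the graph of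
   gamma meets an open set, so do the graphs of all nearby curves.  Hence
   violating [|d(gamma_u, gamma_v) - l |u - v|| <= e |u - v|] at some [u, v] of
   the domain with [|u - t|, |v - t| < d] and
   [|u - v| > a max(|u - t|, |v - t|)] is an open condition on [(x, gamma)].
   The metric derivative at [t] is [l] iff [t] is not isolated and for all [a, e]
   some [d] excludes such violations; by a Cauchy argument its existence, and its
   membership in a given open set, are countable combinations of these
   conditions with [l, e, a, d] rational. *)

Set Implicit Arguments.
Unset Strict Implicit.
Unset Printing Implicit Defensive.

Import Order.TTheory GRing.Theory Num.Theory.
Import numFieldNormedType.Exports.

Local Open Scope classical_set_scope.
Local Open Scope ring_scope.

(** * Closure properties of Borel sets and a criterion for Borel maps *)

Section borel_sets.
Context {T : topologicalType}.
Local Notation borel := <<s @open T >>.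

Lemma borel_open (A : set T) : open A -> borel A.
Proof. exact: sub_sigma_algebra. Qed.

Lemma borelC (A : set T) : borel A -> borel (~` A).
Proof. by move=> /sigma_algebraCD; rewrite setTD. Qed.

(** The union is re-indexed by codes in [nat]; a number that codes no index contributes the empty
    set. *)
Lemma borel_bigcup (I : countType) (F : I -> set T) :
  (forall i, borel (F i)) -> borel (\bigcup_i F i).
Proof.
move=> bF; have -> : \bigcup_i F i = \bigcup_n oapp F set0 (unpickle n).
  apply/seteqP; split=> [x [i _ Fix]|x [n _]].
    by exists (pickle i) => //; rewrite pickleK.
  by case: (unpickle n) => //= i Fix; exists i.
apply: sigma_algebra_bigcup => n; case: (unpickle n) => //=.
exact: sigma_algebra0.
Qed.

Lemma borel_bigcap (I : countType) (F : I -> set T) :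
  (forall i, borel (F i)) -> borel (\bigcap_i F i).
Proof.
move=> bF; rewrite -[X in borel X]setCK setC_bigcap.
exact: borelC (borel_bigcup (fun i => borelC (bF i))).
Qed.

Lemma borelU (A B : set T) : borel A -> borel B -> borel (A `|` B).
Proof.
move=> bA bB; have -> : A `|` B = \bigcup_(b : bool) (if b then A else B).
  apply/seteqP; split=> [x [|]|x [[]]]; first by exists true.
  - by exists false.
  - by left.
  - by right.
have bAB b : borel (if b then A else B) by case: b.
exact: borel_bigcup bAB.
Qed.

Lemma borelI (A B : set T) : borel A -> borel B -> borel (A `&` B).
Proof.
move=> bA bB; rewrite -[X in borel X]setCK setCI.
exact: borelC (borelU (borelC bA) (borelC bB)).
Qed.

End borel_sets.

(** The sets with Borel preimage form a sigma-algebra, so it is enough that it contains the open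
    sets. *)
Lemma Borel_map_open (T U : topologicalType) (f : T -> U) :
  (forall A, open A -> <<s @open T >> (f @^-1` A)) -> Borel_map f.
Proof.
move=> fo; apply: smallest_sub; last exact: fo.
split=> [|A bA|F bF]; first by rewrite preimage_set0; exact: sigma_algebra0.
  by rewrite setTD preimage_setC; exact: borelC bA.
by rewrite preimage_bigcup; exact: borel_bigcup bF.
Qed.

(** * Continuity of distances and stability under Hausdorff perturbation *)

Section metric_continuity.
Context {R : realType} {X : metricType R}.

Lemma mdist_continuous2 : continuous (fun q : X * X => mdist q.1 q.2 : R).
Proof.
move=> [x y]; apply/cvgrPdist_lt => e e0.
have e2 : 0 < e / 2 by rewrite divr_gt0.
have := nbhsx_ballx (x, y) _ e2; apply: filterS => q [].
rewrite !ballEmdist /= => xq yq.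
have := metric_triangle x q.1 y; have := metric_triangle q.1 q.2 y.
have := metric_triangle q.1 x q.2; have := metric_triangle x y q.2.
rewrite /= (metric_sym q.1 x) (metric_sym q.2 y) ltr_norml.
by move=> h1 h2 h3 h4; apply/andP; split; lra.
Qed.

Lemma lt_continuous_open (T : topologicalType) (f g : T -> R) :
  continuous f -> continuous g -> open [set x | f x < g x].
Proof.
move=> cf cg.
have -> : [set x | f x < g x] = (g \- f) @^-1` [set y | 0 < y].
  by apply/seteqP; split=> x /=; rewrite subr_gt0.
apply: open_comp; last exact: open_gt.
by move=> x _; apply: cvgB; [exact: cg|exact: cf].
Qed.

Lemma continuous_dist (T : topologicalType) (f h : T -> R) :
  continuous f -> continuous h -> continuous (fun x => `|f x - h x|).
Proof.
by move=> cf ch x; apply: cvg_norm; apply: cvgB; [exact: cf|exact: ch].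
Qed.

Lemma continuous_scale (T : topologicalType) (c : R) (f : T -> R) :
  continuous f -> continuous (fun x => c * f x).
Proof. by move=> cf x; apply: cvgM; [exact: cvg_cst|exact: cf]. Qed.

Lemma continuous_fst_comp (T U V : topologicalType) (f : T -> U * V) :
  continuous f -> continuous (fun x => (f x).1).
Proof. by move=> cf x; apply: continuous_comp; [exact: cf|exact: cvg_fst]. Qed.

Lemma continuous_snd_comp (T U V : topologicalType) (f : T -> U * V) :
  continuous f -> continuous (fun x => (f x).2).
Proof. by move=> cf x; apply: continuous_comp; [exact: cf|exact: cvg_snd]. Qed.

(** The Hausdorff distance is an infimum of radii of mutual inclusion, so some such radius is below
    [e]. *)
Lemma hausdorff_ball (A B : hyperspace X) (e : R) (q : X) :
  ball A e B -> hset A q -> exists2 q', hset B q' & ball q e q'.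
Proof.
rewrite ballEmdist /= => AB Aq.
have eAB : 0 < e - hausdorff_dist A B by rewrite subr_gt0.
have [d [_ AdB _]] := inf_adherent eAB (hausdorff_radii_has_inf A B).
rewrite -/(hausdorff_dist A B) subrKC => de.
have [q' Bq' /ball_sym qq'] := AdB _ Aq.
by exists q' => //; apply: le_ball qq'; exact: ltW.
Qed.

End metric_continuity.

(** Some [(v, g v)] is [d]-close to [(t', x')]. Then [x] and [g v] are less than [2 * d] apart, so
    [|t - v| <= 2 * L * d], while [|v - t'| < d]. Only the constant of [g] enters, so the bound
    holds for all nearby [h] at once. *)
Lemma graph_time_dist (R : realType) (X : metricType R) (g h : bilip_curve X)
    (L d t t' : R) (x x' : X) : 0 < L ->
    (forall u v : dom g, L^-1 * `|val u - val v| <= mdist (g u) (g v)) ->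
    graph_set g (t, x) -> graph_set h (t', x') ->
    ball (graph g) d (graph h) -> ball x d x' ->
  `|t - t'| < (2 * L + 1) * d.
Proof.
move=> L0 gL [u _ [<- <-]] hx' /ball_sym/hausdorff_ball/(_ hx').
case=> _ [v _ <-] [/= t'v x'v].
rewrite !ballEmdist /= in x'v *; rewrite /ball /= in t'v => ux'.
have := gL u v; rewrite ler_pdivrMl// => uv.
have uvd : mdist (g u) (g v) <= d + d.
  apply: le_trans (metric_triangle _ x' _) _.
  by apply: lerD; exact: ltW.
have {uvd}uv : `|val u - val v| <= L * (d + d).
  by apply: le_trans uv _; rewrite ler_pM2l.
have -> : val u - t' = (val u - val v) - (t' - val v) by rewrite opprB addrA subrK.
by rewrite (le_lt_trans (ler_normB _ _))//; lra.
Qed.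

(** * Continuity of the time, and open conditions on points of the graph *)

Section curve_points_topology.
Context {R : realType} {X : metricType R}.
Local Notation A := (@curve_points R X).
Implicit Types p : A.

(** This is gamma^{-1}(x) as a real number, since the type [dom (val p).2] varies with [p]. *)
Definition point_time p : R := val (curve_preimage p).

Lemma graph_setE (g : bilip_curve X) (t : dom g) : graph_set g (val t, g t).
Proof. by exists t. Qed.

Lemma point_timeP p : graph_set (val p).2 (point_time p, (val p).1).
Proof.
rewrite /point_time /curve_preimage; case: cid => t /= ->.
exact: graph_setE.
Qed.

Lemma point_continuous : continuous (fun p : A => (val p).1).
Proof.
move=> p; apply: (@continuous_comp _ _ _ (val : A -> X * bilip_curve X) fst).
  exact: initial_continuous.
exact: cvg_fst.
Qed.

Lemma graph_continuous : continuous (fun p : A => graph (val p).2).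
Proof.
move=> p.
apply: (@continuous_comp _ _ _ (fun p : A => (val p).2) (@graph R X)); last first.
  exact: initial_continuous.
apply: (@continuous_comp _ _ _ (val : A -> X * bilip_curve X) snd).
  exact: initial_continuous.
exact: cvg_snd.
Qed.

(** A ball around [q] inside [V] contains a graph point of every curve close enough in the Hausdorff
    distance. *)
Lemma graph_meets_open (V : set (R^o * X)) : open V ->
  open [set p : A | exists2 q, graph_set (val p).2 q & V q].
Proof.
move=> oV; rewrite openE => p [q gq Vq]; rewrite /interior.
have /nbhs_ballP[e /= e0 eV] : nbhs q V by exact: open_nbhs_nbhs.
have near_ball : \forall p' \near p, ball (graph (val p).2) e (graph (val p').2).
  apply: (@graph_continuous p).
  by apply/nbhs_ballP; exists e.
apply: (@filterS _ _ (nbhs_filter p) _ _ _ near_ball) => p'.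
move=> /hausdorff_ball/(_ gq)[q' gq' qq'].
by exists q' => //; exact: eV.
Qed.

Lemma point_time_continuous : continuous point_time.
Proof.
move=> p; apply/(cvgrPdist_lt (FF := nbhs_filter p)) => e e0.
have [L L1 gL] := curve_bilip (val p).2.
have L0 : 0 < L by exact: lt_le_trans L1.
(* [2 * L + 1] is the factor from [graph_time_dist], with [L] a constant of the curve of [p]. *)
have [d d0 de] : exists2 d, 0 < d & (2 * L + 1) * d <= e.
  have k : 0 < 2 * L + 1 by lra.
  exists (e / (2 * L + 1)); first by rewrite divr_gt0.
  by rewrite mulrC divfK// gt_eqF.
have nd : \forall p' \near p, ball (graph (val p).2) d (graph (val p').2).
  by apply: (@graph_continuous p); apply: nbhsx_ballx.
have nx : \forall p' \near p, ball (val p).1 d (val p').1.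
  by apply: (@point_continuous p); apply: nbhsx_ballx.
apply: (@filterS2 _ _ (nbhs_filter p) _ _ _ _ nd nx) => p' pd px.
apply: lt_le_trans de; apply: (graph_time_dist L0 _ _ _ pd px).
- by move=> u v; have /andP[] := gL u v.
- exact: point_timeP.
- exact: point_timeP.
Qed.

(** An open [W] contains a product of neighbourhoods of the time and of the two graph points, and
    near [p] each factor is still met. Speed violations and non-isolatedness are both treated in
    this form. *)
Lemma graph_meets2_open (W : set (R^o * (R^o * X) * (R^o * X))) : open W ->
  open [set p : A | exists q1 q2, [/\ graph_set (val p).2 q1,
    graph_set (val p).2 q2 & W (point_time p, q1, q2)]].
Proof.
move=> oW; rewrite openE => p [q1 [q2 [gq1 gq2 Wq]]]; rewrite /interior.
have : nbhs (point_time p : R^o, q1, q2) W by exact: open_nbhs_nbhs.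
case=> -[/= V0 V2] [[[V V1] /= [nV nV1]] V01 nV2] VW.
have [p1 p2] : (\forall p' \near p, exists2 q, graph_set (val p').2 q & V1 q)
    /\ (\forall p' \near p, exists2 q, graph_set (val p').2 q & V2 q).
  move: nV1 nV2; rewrite !nbhsE => -[U1 [oU1 Uq1] UV1] [U2 [oU2 Uq2] UV2].
  have n1 := open_nbhs_nbhs (conj (graph_meets_open oU1) (ex_intro2 _ _ _ gq1 Uq1)).
  have n2 := open_nbhs_nbhs (conj (graph_meets_open oU2) (ex_intro2 _ _ _ gq2 Uq2)).
  split.
    by apply: (@filterS _ _ (nbhs_filter p) _ _ _ n1) => p' [q gq /UV1]; exists q.
  by apply: (@filterS _ _ (nbhs_filter p) _ _ _ n2) => p' [q gq /UV2]; exists q.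
have p0 : \forall p' \near p, V (point_time p').
  exact: (@point_time_continuous p).
apply: (@filterS3 _ _ (nbhs_filter p) _ _ _ _ _ p0 p1 p2).
move=> p' p'0 [r1 gr1 Vr1] [r2 gr2 Vr2].
by exists r1, r2; split=> //; apply: VW; split=> //; apply: V01.
Qed.

End curve_points_topology.

Lemma exists_natSinv_lt (R : realType) (e : R) : 0 < e ->
  exists n, n.+1%:R^-1 < e.
Proof. by move=> /ltr_add_invr[n]; rewrite add0r => ne; exists n. Qed.

Lemma exists_rat_near (R : realType) (l e : R) : 0 < e ->
  exists q : rat, `|ratr q - l| < e.
Proof.
move=> e0; have [|q] := @rat_in_itvoo _ (l - e) (l + e); first by lra.
rewrite in_itv /= => /andP[? ?]; exists q.
by rewrite ltr_norml; apply/andP; split; lra.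
Qed.

(** * The metric derivative in terms of epsilon and delta *)

Section metric_derivative_bound.
Context {R : realType} {X : metricType R}.
Implicit Types (g : bilip_curve X) (a d e l t u v : R).

Lemma measurable_segment u v : measurable (segment u v).
Proof. exact: measurable_itv. Qed.

Lemma lebesgue_measure_segment u v :
  lebesgue_measure (segment u v) = `|u - v|%:E.
Proof.
rewrite /segment lebesgue_measure_itv /= lte_fin.
have [uv|vu|->] := ltgtP u v; last by rewrite ltxx subrr normr0.
- by rewrite uv -EFinD distrC gtr0_norm// subr_gt0.
- by rewrite vu -EFinD gtr0_norm// subr_gt0.
Qed.

Lemma segment_subset_ball t d u v :
  segment u v `<=` ball t d <-> `|u - t| < d /\ `|v - t| < d.
Proof.
rewrite ball_itv; split=> [sub|[]].
  have su : segment u v u.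
    by rewrite /segment /= in_itv /= ge_min le_max lexx.
  have sv : segment u v v.
    by rewrite /segment /= in_itv /= ge_min le_max lexx !orbT.
  move: (sub _ su) (sub _ sv); rewrite /= !in_itv /= !ltr_norml.
  by move=> /andP[? ?] /andP[? ?]; split; apply/andP; split; lra.
rewrite !ltr_norml => /andP[? ?] /andP[? ?] z.
rewrite /segment /= !in_itv /= ge_min le_max.
move=> /andP[h1 h2]; apply/andP; split.
  by case/orP: h1 => ?; lra.
by case/orP: h2 => ?; lra.
Qed.

(** The constant [a] plays the role of nice shrinking. All inequalities are strict, which makes the
    condition open. *)
Definition admissible a d t u v := [/\ `|u - t| < d, `|v - t| < d,
  a * `|u - t| < `|u - v| & a * `|v - t| < `|u - v|].

(** Quantifying over graph points avoids elements of the dependent type [dom g]; multiplying out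
    avoids a quotient. *)
Definition speed_within g t l e a d := forall q1 q2 : R^o * X,
  graph_set g q1 -> graph_set g q2 -> admissible a d t q1.1 q2.1 ->
  `|mdist q1.2 q2.2 - l * `|q1.1 - q2.1| | <= e * `|q1.1 - q2.1|.

Lemma shrink_nicelyP t (s tau : R^nat) :
  shrink_nicely t (fun n => segment (t + s n) (t + tau n)) <->
  exists2 a, 0 < a & forall n,
    a * `|s n| < `|s n - tau n| /\ a * `|tau n| < `|s n - tau n|.
Proof.
have dE n : `|t + s n - (t + tau n)| = `|s n - tau n|.
  by rewrite opprD addrACA subrr add0r.
split=> [[_ [r [a [a0 rP]]]]|[a a0 aP]].
  (* The same constant serves: the ball has length [2 * r n], so [a * |s n| < a * r n < 2 * a * r n
     <= |s n - tau n|], and likewise for [tau n]. *)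
  exists a => // n; have [rn sub] := rP n.
  rewrite lebesgue_measure_ball; last exact: ltW.
  rewrite lebesgue_measure_segment dE -EFinM lee_fin mulr2n mulrDr => ar.
  move/segment_subset_ball: sub; rewrite ![t + _]addrC !addrK => -[sr taur].
  have ar0 : 0 < a * r n by exact: mulr_gt0.
  have h1 : a * `|s n| < a * r n by rewrite ltr_pM2l.
  have h2 : a * `|tau n| < a * r n by rewrite ltr_pM2l.
  by split; lra.
split; first by move=> n; exact: measurable_segment.
(* The second summand makes the radius exceed both [|s n|] and [|tau n|]. Each summand is at most
   [|s n - tau n| / a], so the ball has length at most [4 * |s n - tau n| / a]. *)
exists (fun n => Num.max `|s n| `|tau n| + `|s n - tau n| / a), (a / 4).
split; first by rewrite divr_gt0.
move=> n; have [h1 h2] := aP n.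
have st0 : 0 < `|s n - tau n|.
  by apply: le_lt_trans h1; rewrite mulr_ge0// ltW.
have sta0 : 0 < `|s n - tau n| / a by rewrite divr_gt0.
have r0 : 0 < Num.max `|s n| `|tau n| + `|s n - tau n| / a.
  by rewrite ltr_wpDl// le_max normr_ge0.
split=> //.
  apply/segment_subset_ball; rewrite ![t + _]addrC !addrK.
  by split; rewrite ltr_pwDr// le_max lexx ?orbT.
rewrite lebesgue_measure_ball; last exact: ltW.
rewrite lebesgue_measure_segment dE -EFinM lee_fin.
have am : a * Num.max `|s n| `|tau n| <= `|s n - tau n|.
  by rewrite maxEle; case: ifP => _; exact: ltW.
have aa : a * (`|s n - tau n| / a) = `|s n - tau n|.
  by rewrite mulrC divfK// gt_eqF.
by rewrite mulr2n; lra.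
Qed.

Lemma is_metric_derivativeP g (t : dom g) l :
  is_metric_derivative t l <-> ~ isolated (dom g) (val t) /\
  forall e a, 0 < e -> 0 < a ->
    exists2 d, 0 < d & speed_within g (val t) l e a d.
Proof.
split=> -[it H]; split=> //.
  move=> e a e0 a0; apply: contrapT => /forall2NP nd.
  (* Violations at every scale [1 / (n + 1)] give nicely shrinking sequences along which the
     quotient stays more than [e] away from [l]. *)
  have /choice[q qP] n : exists q : (R^o * X) * (R^o * X),
      [/\ graph_set g q.1, graph_set g q.2,
        admissible a n.+1%:R^-1 (val t) q.1.1 q.2.1 &
        ~ `|mdist q.1.2 q.2.2 - l * `|q.1.1 - q.2.1| | <= e * `|q.1.1 - q.2.1|].
    have [//|/existsNP[q1 /existsNP[q2]]] := nd n.+1%:R^-1.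
    by move=> /not_implyP[g1 /not_implyP[g2 /not_implyP[ad ne]]]; exists (q1, q2).
  pose s n : R := (q n).1.1 - val t; pose tau n : R := (q n).2.1 - val t.
  have sE n : val t + s n = (q n).1.1 by rewrite /s addrC subrK.
  have tauE n : val t + tau n = (q n).2.1 by rewrite /tau addrC subrK.
  have stE n : s n - tau n = (q n).1.1 - (q n).2.1.
    by rewrite /s /tau opprB addrA subrK.
  have hs n : val t + s n \in dom g.
    by rewrite sE; have [[u _ <-] _ _ _] := qP n; exact: valP.
  have htau n : val t + tau n \in dom g.
    by rewrite tauE; have [_ [u _ <-] _ _] := qP n; exact: valP.
  have gs n : g (SigSub (hs n)) = (q n).1.2.
    have [[u _ uE] _ _ _] := qP n; rewrite -uE; congr (g _).
    by apply: val_inj => /=; rewrite sE -uE.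
  have gtau n : g (SigSub (htau n)) = (q n).2.2.
    have [_ [u _ uE] _ _] := qP n; rewrite -uE; congr (g _).
    by apply: val_inj => /=; rewrite tauE -uE.
  have to0 (w : R^nat) : (forall n, `|w n| < n.+1%:R^-1) ->
      w n @[n --> \oo] --> (0 : R).
    move=> wn; apply/cvgrPdist_lt => z z0.
    have := near_infty_natSinv_lt (PosNum z0); apply: filterS => n /=.
    by rewrite sub0r normrN; apply: lt_trans.
  have s0 : s n @[n --> \oo] --> (0 : R) by apply: to0 => n; have [_ _ []] := qP n.
  have tau0 : tau n @[n --> \oo] --> (0 : R) by apply: to0 => n; have [_ _ []] := qP n.
  have sh : shrink_nicely (val t) (fun n => segment (val t + s n) (val t + tau n)).
    apply/shrink_nicelyP; exists a => // n; rewrite stE.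
    by have [_ _ []] := qP n.
  have /cvgrPdist_lt/(_ _ e0)[n _ /(_ n (leqnn n))] := H s tau hs htau s0 tau0 sh.
  have [_ _ [_ _ + _] ne] := qP n.
  rewrite /= gs gtau stE => h.
  set D := `|(q n).1.1 - (q n).2.1| in h ne *.
  have D0 : 0 < D by apply: le_lt_trans h; rewrite mulr_ge0// ltW.
  move=> lt_e; apply: ne.
  rewrite -ler_pdivrMr// -[X in _ / X](gtr0_norm D0) -normf_div mulrBl mulfK ?gt_eqF//.
  by rewrite distrC ltW.
move=> s tau hs htau s0 tau0 /shrink_nicelyP[a a0 aP].
apply/cvgrPdist_lt => e e0.
(* Half of [e] turns the non-strict bound into the strict one of the limit. *)
have [d d0 dP] := H (e / 2) a (divr_gt0 e0 (ltr0n _ 2)) a0.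
move/cvgrPdist_lt/(_ _ d0) : s0; move/cvgrPdist_lt/(_ _ d0) : tau0.
apply: filterS2 => n; rewrite !sub0r !normrN => taud sd.
have [h1 h2] := aP n.
have := dP _ _ (graph_setE (SigSub (hs n))) (graph_setE (SigSub (htau n))).
rewrite /admissible /=; set M := mdist _ _.
rewrite ![val t + _]addrC !addrK.
have -> : s n + val t - (tau n + val t) = s n - tau n.
  by rewrite opprD addrACA subrr addr0.
move=> /(_ (And4 sd taud h1 h2)).
set D := `|s n - tau n| in h1 *.
have D0 : 0 < D by apply: le_lt_trans h1; rewrite mulr_ge0// ltW.
rewrite -ler_pdivrMr// -[X in _ / X](gtr0_norm D0) -normf_div mulrBl mulfK ?gt_eqF//.
by rewrite distrC => /le_lt_trans; apply; lra.
Qed.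

End metric_derivative_bound.

(** * Approximate derivatives and the Cauchy criterion *)

Section eventual_bounds.
Context {R : realType} {X : metricType R}.
Implicit Types (g : bilip_curve X) (a d e l t u v : R).

Lemma not_isolatedP (E : set R) t : E t -> ~ isolated E t <->
  forall d, 0 < d -> exists u, [/\ E u, 0 < `|u - t| & `|u - t| < d].
Proof.
move=> Et; split=> [it d d0|H [_ [V /nbhs_ballP[d /= d0 dV] VE]]].
  apply: contrapT => /forallNP nu; apply: it; split; first exact: mem_set.
  exists (ball t d); first exact: nbhsx_ballx.
  apply/seteqP; split=> [u [tu Eu]|_ ->]; last by split=> //; exact: ballxx.
  apply/eqP; apply/negP => /negP ut; apply: (nu u); split=> //.
    by rewrite normr_gt0 subr_eq0.
  by rewrite distrC.
have [u [Eu ut0 utd]] := H _ d0.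
have : (V `&` E) u by split=> //; apply: dV; rewrite /ball /= distrC.
by rewrite VE /= => ut; rewrite ut subrr normr0 ltxx in ut0.
Qed.

(** A larger [a] or a smaller [d] leaves fewer admissible pairs, and replacing [l] by [l'] costs
    [|l - l'| * |u - v|]. *)
Lemma speed_withinW g t l l' e e' a a' d d' :
  `|l - l'| + e <= e' -> a <= a' -> d' <= d ->
  speed_within g t l e a d -> speed_within g t l' e' a' d'.
Proof.
move=> le_e le_a le_d H q1 q2 gq1 gq2 [h1 h2 h3 h4].
have {h1 h2 h3 h4}/(H _ _ gq1 gq2) : admissible a d t q1.1 q2.1.
  split; [exact: lt_le_trans le_d|exact: lt_le_trans le_d| |].
    by apply: le_lt_trans h3; rewrite ler_wpM2r.
  by apply: le_lt_trans h4; rewrite ler_wpM2r.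
set D := `|q1.1 - q2.1|; set M := mdist _ _ => HD.
have -> : M - l' * D = (M - l * D) + (l - l') * D.
  by rewrite mulrBl addrA subrK.
have D0 : 0 <= D by exact: normr_ge0.
apply: le_trans (ler_normD _ _) _; rewrite normrM (ger0_norm D0).
apply: (@le_trans _ _ ((`|l - l'| + e) * D)); last by rewrite ler_wpM2r.
by rewrite mulrDl addrC lerD2l.
Qed.

(** [l] is a derivative up to the fixed error [e], with [d] depending on [a]; this allows rational
    [l]. *)
Definition eventually_within g t l e := forall a, 0 < a ->
  exists2 d, 0 < d & speed_within g t l e a d.

Lemma eventually_withinW g t l l' e e' : `|l - l'| + e <= e' ->
  eventually_within g t l e -> eventually_within g t l' e'.
Proof.
move=> le_e H a /H[d d0 dP]; exists d => //.
exact: speed_withinW le_e _ _ dP.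
Qed.

Lemma eventually_within_natP g t l e : eventually_within g t l e <->
  forall k, exists m, speed_within g t l e k.+1%:R^-1 m.+1%:R^-1.
Proof.
split=> [H k|H a a0].
  have [|d /exists_natSinv_lt[m md] dP] := H k.+1%:R^-1; first by rewrite invr_gt0.
  exists m; apply: speed_withinW dP => //; last exact: ltW.
  by rewrite subrr normr0 add0r.
have [k ka] := exists_natSinv_lt a0; have [m mP] := H k.
exists m.+1%:R^-1; first by rewrite invr_gt0.
apply: speed_withinW mP => //; last exact: ltW.
by rewrite subrr normr0 add0r.
Qed.

(** At a non-isolated [t] both bounds apply to a pair [(u, t)] with [u] different from [t]; subtract
    them and divide by [|u - t|]. *)
Lemma eventually_within_dist g (t : dom g) l l' e e' :
  ~ isolated (dom g) (val t) ->
  eventually_within g (val t) l e -> eventually_within g (val t) l' e' ->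
  `|l - l'| <= e + e'.
Proof.
move=> /(not_isolatedP (set_valP t)) it H H'.
(* Any constant in (0, 1) makes [(u, t)] admissible. *)
have a0 : 0 < 2^-1 :> R by rewrite invr_gt0.
have [d d0 dP] := H _ a0; have [d' d'0 d'P] := H' _ a0.
have [u [gu ut]] := it (Num.min d d') ltac:(by rewrite lt_min d0).
rewrite lt_min => /andP[utd utd'].
have gu' := graph_setE (SigSub (mem_set gu)).
have ad r : 0 < r -> `|u - val t| < r -> admissible 2^-1 r (val t) u (val t).
  by move=> r0 utr; split=> //; rewrite ?subrr ?normr0 ?mulr0//; lra.
have := d'P _ _ gu' (graph_setE t) (ad _ d'0 utd').
have := dP _ _ gu' (graph_setE t) (ad _ d0 utd).
rewrite /=; set M := mdist _ _; set D := `|u - val t| in ut * => h h'.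
rewrite -(ler_pM2r ut) -[X in _ * X <= _](gtr0_norm ut) -normrM.
have -> : (l - l') * D = (M - l' * D) - (M - l * D).
  by ring.
by rewrite (le_trans (ler_normB _ _))// mulrDl addrC lerD.
Qed.

Lemma is_metric_derivative_unique g (t : dom g) l l' :
  is_metric_derivative t l -> is_metric_derivative t l' -> l = l'.
Proof.
move=> /is_metric_derivativeP[it H] /is_metric_derivativeP[_ H'].
apply/eqP; rewrite -subr_eq0 -normr_le0; apply/ler_addgt0Pl => e e0.
have e2 : 0 < e / 2 by rewrite divr_gt0.
rewrite addr0 [e]splitr; apply: (eventually_within_dist it).
- by move=> a; exact: H.
- by move=> a; exact: H'.
Qed.

(** For the converse, the intervals of centre [q n] and radius [1 / (n + 1)] pairwise meet, hence
    have a common point, which is the derivative. *)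
Lemma metric_differentiableP g (t : dom g) : metric_differentiable t <->
  ~ isolated (dom g) (val t) /\ forall n, exists q : rat,
    eventually_within g (val t) (ratr q) n.+1%:R^-1.
Proof.
split=> [[l /is_metric_derivativeP[it H]]|[it /choice[q qP]]].
  split=> // n; have n0 : 0 < n.+1%:R^-1 :> R by rewrite invr_gt0.
  (* Half of the tolerance pays for replacing [l] by [q], the other half for the approach to [l]. *)
  have [q ql] := exists_rat_near l (divr_gt0 n0 (ltr0n R 2)); exists q.
  refine (eventually_withinW (l := l) (e := n.+1%:R^-1 / 2) _ _).
    by rewrite distrC [leRHS]splitr lerD2r ltW.
  by move=> a; apply: H; rewrite divr_gt0.
have qq n m : ratr (q n) - n.+1%:R^-1 <= ratr (q m) + m.+1%:R^-1 :> R.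
  have := eventually_within_dist it (qP n) (qP m).
  move=> /(le_trans (ler_norm _)).
  by rewrite lerBlDr -addrA -lerBlDl [_^-1 + _]addrC.
(* The derivative is the supremum of the lower bounds [q n - (n+1)^-1]. *)
pose S := range (fun n => ratr (q n) - n.+1%:R^-1 : R).
have S0 : S !=set0 by exists (ratr (q 0%N) - 1%:R^-1); exists 0%N.
have Sub m : ubound S (ratr (q m) + m.+1%:R^-1) by move=> _ [n _ <-].
have lq n : `|ratr (q n) - sup S| <= n.+1%:R^-1.
  have : ratr (q n) - n.+1%:R^-1 <= sup S.
    by apply: ub_le_sup; [exists (ratr (q 0%N) + 1%:R^-1); exact: Sub|exists n].
  have : sup S <= ratr (q n) + n.+1%:R^-1 by exact: ge_sup.
  by move: (n.+1%:R^-1) => z; rewrite ler_norml => ? ?; apply/andP; split; lra.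
exists (sup S); apply/is_metric_derivativeP; split=> // e a e0 a0.
(* [1 / (n + 1)] is spent twice: as the error of [q n], and in passing from [q n] to the
   supremum. *)
have [n ne] := exists_natSinv_lt (divr_gt0 e0 (ltr0n R 2)).
refine (eventually_withinW _ (qP n) a0).
by rewrite [leRHS]splitr lerD ?(le_trans (lq n)) ?ltW.
Qed.

End eventual_bounds.

(** * Borel measurability of the metric speed *)

Section borel_speed.
Context {R : realType} {X : metricType R}.
Local Notation A := (@curve_points R X).
Local Notation borel := <<s @open A >>.
Local Notation triple := (R^o * (R^o * X) * (R^o * X))%type.

Lemma base_continuous : continuous (fun z : triple => z.1.1 : R).
Proof. by do 2!apply: continuous_fst_comp; move=> z; exact: cvg_id. Qed.

Lemma left_continuous : continuous (fun z : triple => z.1.2).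
Proof.
by apply: continuous_snd_comp; apply: continuous_fst_comp => z; exact: cvg_id.
Qed.

Lemma right_continuous : continuous (fun z : triple => z.2).
Proof. by apply: continuous_snd_comp => z; exact: cvg_id. Qed.

Lemma left_time_continuous : continuous (fun z : triple => z.1.2.1 : R).
Proof. exact: continuous_fst_comp left_continuous. Qed.

Lemma right_time_continuous : continuous (fun z : triple => z.2.1 : R).
Proof. exact: continuous_fst_comp right_continuous. Qed.

Lemma points_dist_continuous :
  continuous (fun z : triple => mdist z.1.2.2 z.2.2 : R).
Proof.
move=> z; apply: (@continuous_comp _ _ _ (fun z : triple => (z.1.2.2, z.2.2))
  (fun q : X * X => mdist q.1 q.2 : R)); last exact: mdist_continuous2.
apply: cvg_pair; first exact: (continuous_snd_comp left_continuous).
exact: (continuous_snd_comp right_continuous).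
Qed.

(** A triple consists of the time and two graph points; every condition is a strict inequality
    between continuous functions of it. *)
Lemma open_speed_violation (l e a d : R) : open [set z : triple |
  admissible a d z.1.1 z.1.2.1 z.2.1 /\
  e * `|z.1.2.1 - z.2.1| < `|mdist z.1.2.2 z.2.2 - l * `|z.1.2.1 - z.2.1| | ].
Proof.
have c1 := continuous_dist left_time_continuous base_continuous.
have c2 := continuous_dist right_time_continuous base_continuous.
have c3 := continuous_dist left_time_continuous right_time_continuous.
have c4 := continuous_dist points_dist_continuous (continuous_scale (c := l) c3).
have cd : continuous (fun _ : triple => d) by move=> z; exact: cvg_cst.
have -> : [set z : triple | admissible a d z.1.1 z.1.2.1 z.2.1 /\
    e * `|z.1.2.1 - z.2.1| < `|mdist z.1.2.2 z.2.2 - l * `|z.1.2.1 - z.2.1| | ] =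
    [set z : triple | `|z.1.2.1 - z.1.1| < d] `&`
    [set z : triple | `|z.2.1 - z.1.1| < d] `&`
    [set z : triple | a * `|z.1.2.1 - z.1.1| < `|z.1.2.1 - z.2.1|] `&`
    [set z : triple | a * `|z.2.1 - z.1.1| < `|z.1.2.1 - z.2.1|] `&`
    [set z : triple | e * `|z.1.2.1 - z.2.1| <
       `|mdist z.1.2.2 z.2.2 - l * `|z.1.2.1 - z.2.1| | ].
  by apply/seteqP; split=> z [] => [[? ? ? ?] ?|[[[? ?] ?] ?] ?].
do 4?apply: openI.
- exact: lt_continuous_open c1 cd.
- exact: lt_continuous_open c2 cd.
- exact: (lt_continuous_open (continuous_scale (c := a) c1) c3).
- exact: (lt_continuous_open (continuous_scale (c := a) c2) c3).
- exact: (lt_continuous_open (continuous_scale (c := e) c3) c4).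
Qed.

Lemma open_not_speed_within (l e a d : R) :
  open (~` [set p : A | speed_within (val p).2 (point_time p) l e a d]).
Proof.
have := graph_meets2_open (@open_speed_violation l e a d).
congr (open _); apply/seteqP; split=> p /=.
  move=> [q1 [q2 [g1 g2 [ad lt]]]] /(_ _ _ g1 g2 ad).
  by rewrite leNgt lt.
move=> /existsNP[q1 /existsNP[q2]].
move=> /not_implyP[g1 /not_implyP[g2 /not_implyP[ad /negP]]].
by rewrite -ltNge => ne; exists q1, q2.
Qed.

Lemma borel_eventually_within (l e : R) :
  borel [set p : A | eventually_within (val p).2 (point_time p) l e].
Proof.
have -> : [set p : A | eventually_within (val p).2 (point_time p) l e] =
    \bigcap_(k in [set: nat]) \bigcup_(m in [set: nat])
    [set p : A | speed_within (val p).2 (point_time p) l e k.+1%:R^-1 m.+1%:R^-1].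
  apply/seteqP; split=> p.
    by move=> /eventually_within_natP H k _; have [m mP] := H k; exists m.
  by move=> H; apply/eventually_within_natP => k; have [m _ mP] := H k I; exists m.
apply: borel_bigcap => k; apply: borel_bigcup => m.
by rewrite -[X in borel X]setCK; apply: borelC;
  apply: borel_open; exact: open_not_speed_within.
Qed.

Lemma open_punctured_ball (d : R) : open [set z : triple |
  0 < `|z.1.2.1 - z.1.1| /\ `|z.1.2.1 - z.1.1| < d].
Proof.
have c1 := continuous_dist left_time_continuous base_continuous.
have cst (c : R) : continuous (fun _ : triple => c) by move=> z; exact: cvg_cst.
exact: openI (lt_continuous_open (cst 0) c1) (lt_continuous_open c1 (cst d)).
Qed.

Lemma borel_not_isolated :
  borel [set p : A | ~ isolated (dom (val p).2) (point_time p)].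
Proof.
have domP (g : bilip_curve X) u : dom g u <-> exists x, graph_set g (u, x).
  split=> [gu|[x [v _ [<- _]]]]; last exact: set_valP.
  by exists (g (SigSub (mem_set gu))); exact: graph_setE (SigSub (mem_set gu)).
have -> : [set p : A | ~ isolated (dom (val p).2) (point_time p)] =
    \bigcap_(k in [set: nat]) [set p : A | exists q1 q2,
      [/\ graph_set (val p).2 q1, graph_set (val p).2 q2 &
      0 < `|q1.1 - point_time p| /\ `|q1.1 - point_time p| < k.+1%:R^-1]].
  apply/seteqP; split=> p; rewrite /= (not_isolatedP (set_valP (curve_preimage p))).
    move=> H k _; have [|u [/domP[x ux] ut utk]] := H k.+1%:R^-1.
      by rewrite invr_gt0.
    (* Only the first graph point is constrained; repeating it fits the two-point form of
       [graph_meets2_open]. *)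
    by exists (u, x), (u, x).
  move=> H d /exists_natSinv_lt[k kd].
  have [[u x] [_ [/= gu _ [ut utk]]]] := H k I.
  exists u; split=> //; last exact: lt_trans kd.
  by apply/domP; exists x.
apply: borel_bigcap => k; apply: borel_open.
exact: (graph_meets2_open (@open_punctured_ball k.+1%:R^-1)).
Qed.

Lemma borel_metric_differentiable :
  borel [set p : A | metric_differentiable (curve_preimage p)].
Proof.
have -> : [set p : A | metric_differentiable (curve_preimage p)] =
    [set p : A | ~ isolated (dom (val p).2) (point_time p)] `&`
    \bigcap_(n in [set: nat]) \bigcup_(q in [set: rat])
    [set p : A | eventually_within (val p).2 (point_time p) (ratr q) n.+1%:R^-1].
  apply/seteqP; split=> p.
    move=> /metric_differentiableP[it H]; split=> // n _.
    by have [q qP] := H n; exists q.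
  move=> [it H]; apply/metric_differentiableP; split=> // n.
  by have [q _ qP] := H n I; exists q.
apply: borelI; first exact: borel_not_isolated.
by apply: borel_bigcap => n; apply: borel_bigcup => q; exact: borel_eventually_within.
Qed.

(** Uniqueness of the derivative makes the value independent of the choice made by [cid]. *)
Lemma metric_speedE (p : A) (l : R) :
  is_metric_derivative (curve_preimage p) l -> metric_speed p = l%:E.
Proof.
rewrite /metric_speed => pl; case: pselect => [h|[]]; last by exists l.
congr (_%:E); rewrite /metric_derivative; case: cid => l' pl' /=.
exact: is_metric_derivative_unique pl' pl.
Qed.

Lemma metric_speed_pinfty (p : A) :
  ~ metric_differentiable (curve_preimage p) -> metric_speed p = +oo%E.
Proof. by rewrite /metric_speed; case: pselect. Qed.

(** A derivative lies in [U] iff it is detected by a rational closed interval whose points all lie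
    in [U]. The points without derivative all have value [+oo], so all or none of them belong to the
    preimage. *)
Lemma metric_speed_preimage (U : set (\bar R)) : open U ->
  metric_speed @^-1` U =
    ([set p : A | metric_differentiable (curve_preimage p)] `&`
     \bigcup_(i in [set: rat * nat])
     [set p : A | (forall y : R, `|y - ratr i.1| <= i.2.+1%:R^-1 -> U y%:E) /\
       eventually_within (val p).2 (point_time p) (ratr i.1) i.2.+1%:R^-1]) `|`
    (~` [set p : A | metric_differentiable (curve_preimage p)] `&`
     [set _ | U +oo%E]).
Proof.
move=> oU; apply/seteqP; split=> p /=.
  have [[l pl]|dp] := pselect (metric_differentiable (curve_preimage p)); last first.
    by rewrite metric_speed_pinfty//; right.
  rewrite (metric_speedE pl) => Ul; left; split; first by exists l.
  have /nbhs_ballP[e /= e0 eU] : nbhs l [set y : R | U y%:E].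
    exact: (open_nbhs_nbhs (conj oU Ul)).
  (* Then [|y - l| <= |y - q| + |q - l|] is below [3 / 2 * (1 / (n + 1))], hence below [e]. *)
  have [n ne] := exists_natSinv_lt (divr_gt0 e0 (ltr0n R 2)).
  have n0 : 0 < n.+1%:R^-1 :> R by rewrite invr_gt0.
  have [q ql] := exists_rat_near l (divr_gt0 n0 (ltr0n R 2)).
  exists (q, n) => //=; split=> [y yq|].
    apply: eU; rewrite /ball /= -(subrK (ratr q) l) -addrA.
    rewrite distrC in ql; rewrite distrC in yq.
    rewrite (le_lt_trans (ler_normD _ _))//.
    by move: (n.+1%:R^-1) n0 ne ql yq => z; lra.
  have /is_metric_derivativeP[_ H] := pl.
  refine (eventually_withinW (l := l) (e := n.+1%:R^-1 / 2) _ _).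
    by rewrite distrC [leRHS]splitr lerD2r ltW.
  by move=> a; apply: H; rewrite divr_gt0.
move=> [[[l pl] [[q n] _ /= [qU qn]]]|[dp U8]]; last by rewrite metric_speed_pinfty.
rewrite (metric_speedE pl); apply: qU.
have /is_metric_derivativeP[it H] := pl.
(* The error at [l] is arbitrarily small, so [|l - q| <= 1 / (n + 1)]; equality can occur, hence
   closed intervals. *)
apply/ler_addgt0Pl => e e0; apply: (eventually_within_dist it _ qn).
by move=> a; exact: H.
Qed.

End borel_speed.

Theorem lemma4p1 (R : realType) (X : metricType R)
  (X_complete : complete_space X) (X_separable : separable_space X) :
  Borel_map (@metric_speed R X).
Proof.
apply: Borel_map_open => U oU; rewrite metric_speed_preimage//.
(* A condition that does not involve the point defines the whole space or the empty set. *)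
have cst (P : Prop) : <<s @open (@curve_points R X) >> [set _ | P].
  by apply: borel_open; have [HP|HP] := pselect P;
    [rewrite (_ : [set _ | P] = setT)|rewrite (_ : [set _ | P] = set0)];
    rewrite ?predeqE//; [exact: openT|exact: open0].
apply: borelU; apply: borelI.
- exact: borel_metric_differentiable.
- apply: borel_bigcup => i.
  exact: borelI (cst _) (borel_eventually_within _ _).
- exact: borelC borel_metric_differentiable.
- exact: cst.
Qed.
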